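(* Let $\ell\ge2$ be an integer. The only strong $\ell$th order sequences are scaled corollas: a sequence $(t_n)_{n\ge1}\in\mathcal{S}eq$ is a strong $\ell$th order sequence if and only if there are nonzero scalars $\alpha_n\in\mathbb{K}$ with $t_n=\alpha_nc_n$ for all $n\ge1$ and $(\lambda_{i,1})_{i\ge1}$ is given by a polynomial in $i$ of degree exactly $\ell$, where $c_n$ denotes the corolla with $n$ vertices.
   Context: $\mathbb{K}$ is a field of characteristic zero. $H_{CK}$ is the Connes-Kreimer Hopf algebra of rooted trees over $\mathbb{K}$: the polynomial algebra on the set of nonempty (non-planar) rooted trees, monomials being identified with forests, unit $1$ = empty forest, graded by the number of vertices. The coproduct is the algebra morphism given on a tree $t$ by $\Delta(t)=t\otimes 1+1\otimes t+\sum_c P^c(t)\otimes R^c(t)$, where $c$ runs over non-empty admissible cuts (non-empty sets of edges containing at most one edge of any path from the root to a leaf), $R^c(t)$ is the component containing the root after removing the edges of $c$, and $P^c(t)$ is the forest of the other components. $\bullet$ is the one-vertex tree. The corolla $c_n$ is the rooted tree with $n$ vertices in which all $n-1$ non-root vertices are leaves that are children of the root ($c_1=\bullet$). $\mathcal{S}eq$ is the set of sequences $(t_n)_{n\ge1}$ in $H_{CK}$ such that each $t_n$ is a nonzero linear combination of trees with $n$ vertices, $t_1=\bullet$, and the subalgebra generated by the $t_n$ is a Hopf subalgebra. The $\Lambda$-array of $(t_n)\in\mathcal{S}eq$ is $(\lambda_{i,j})_{i,j\ge1}$, where $\lambda_{i,j}$ is the coefficient of $t_j\otimes t_i$ in $\Delta(t_{i+j})$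 (in the basis of tensors of monomials in the $t_n$). The sequence $(t_n)$ is a strong $k$th order sequence if for every $j\ge1$, $\lambda_{i,j}$ is given by a polynomial in $i$ of degree at most $k$ (the zero polynomial being allowed), and for $j=1$ the degree is exactly $k$. *)

(* Defs.v *)
From HB Require Import structures.
From mathcomp Require Export all_boot all_order all_algebra.
From mathcomp Require Export finmap monalg.

Set Implicit Arguments.
Unset Strict Implicit.
Unset Printing Implicit Defensive.

Import GRing.Theory.

Local Open Scope fset_scope.
Local Open Scope ring_scope.

(* ** Rooted trees *)

Inductive ptree := PNode of seq ptree.

Definition pchildren (t : ptree) : seq ptree := let: PNode s := t in s.
Definition pleaf : ptree := PNode [::].

Lemma ptree_seq_ind (P : ptree -> Prop) :
  (forall s, (forall i, i < size s -> P (nth pleaf s i))%N -> P (PNode s)) ->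
  forall t, P t.
Proof.
move=> IH; fix REC 1 => -[s]; apply: IH.
elim: s => [|u s IHs] [] => [h|i h|_|i h].
- by clear REC.
- by clear REC.
- exact: REC u.
- exact: IHs i h.
Qed.

Fixpoint ptree_encode (t : ptree) : GenTree.tree void :=
  let: PNode s := t in GenTree.Node 0 (map ptree_encode s).

Fixpoint ptree_decode (t : GenTree.tree void) : ptree :=
  if t is GenTree.Node _ s then PNode (map ptree_decode s) else pleaf.

Lemma ptree_encodeK : cancel ptree_encode ptree_decode.
Proof.
elim/ptree_seq_ind => s IH /=; congr PNode; rewrite -map_comp.
apply: (@eq_from_nth _ pleaf) => [|i]; rewrite size_map // => lt_i.
by rewrite (nth_map pleaf) //= IH.
Qed.

HB.instance Definition _ := Countable.copy ptree (can_type ptree_encodeK).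

(* An arbitrary total order on planar trees, used only to sort siblings. *)
Definition ptree_le : rel ptree := relpre choice.pickle leq.

Lemma ptree_le_total : total ptree_le.
Proof. by move=> x y; apply: leq_total. Qed.

Lemma ptree_le_trans : transitive ptree_le.
Proof. by move=> y x z; apply: leq_trans. Qed.

Lemma ptree_le_anti : antisymmetric ptree_le.
Proof.
by move=> x y; rewrite /ptree_le /= -eqn_leq => /eqP; apply: (pcan_inj choice.pickleK).
Qed.

Fixpoint normalize (t : ptree) : ptree :=
  let: PNode s := t in PNode (sort ptree_le (map normalize s)).

Lemma normalizeK t : normalize (normalize t) == normalize t.
Proof.
apply/eqP; elim/ptree_seq_ind: t => s IH /=; congr PNode.
rewrite (_ : map normalize _ = sort ptree_le (map normalize s)).
  exact: (sorted_sort ptree_le_trans) (sort_sorted ptree_le_total _).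
rewrite -[RHS]map_id; apply/eq_in_map => v.
by rewrite mem_sort => /mapP[u /(nthP pleaf)[i lt_i <-] ->]; apply: IH.
Qed.

(* A non-planar rooted tree is a planar tree up to reordering of siblings, *)
(* represented by its sorted planar representative; see of_planarP.        *)
Record tree := Tree { planar :> ptree; _ : normalize planar == planar }.

HB.instance Definition _ := [isSub for planar].
HB.instance Definition _ := [Countable of tree by <:].

Definition of_planar (t : ptree) : tree := Tree (normalizeK t).

Lemma of_planarK : cancel planar of_planar.
Proof. by move=> t; apply/val_inj/eqP; case: t. Qed.

Lemma of_planarP (s s' : seq ptree) :
  reflect (of_planar (PNode s) = of_planar (PNode s'))
          (perm_eq (map of_planar s) (map of_planar s')).
Proof.
have -> : perm_eq (map of_planar s) (map of_planar s')
        = perm_eq (map normalize s) (map normalize s').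
  have E u : map normalize u = map planar (map of_planar u).
    by rewrite -map_comp.
  rewrite !E; apply/idP/idP => [|h]; first exact: perm_map.
  exact: (perm_map_inj val_inj).
apply: (iffP (perm_sortP ptree_le_total ptree_le_trans ptree_le_anti _ _)).
  by move=> h; apply: val_inj; rewrite /= h.
by move=> /(congr1 planar) [].
Qed.

(* ** Vertices, edges and cuts *)

(* A vertex is the sequence of child indices leading to it from the root. *)
Fixpoint vertices (t : ptree) : seq (seq nat) :=
  let: PNode s := t in
  [::] :: [seq i :: p | i <- iota 0 (size s), p <- nth [::] (map vertices s) i].

Definition nvertices (t : ptree) : nat := size (vertices t).

Fixpoint subtree (t : ptree) (v : seq nat) : ptree :=
  if v is i :: v' then subtree (nth pleaf (pchildren t) i) v' else t.

Definition leaves (t : ptree) : seq (seq nat) :=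
  [seq v <- vertices t | pchildren (subtree t v) == [::]].

(* An edge is named by its endpoint farther from the root. Thus the edges of *)
(* the path from the root to v are the nonempty prefixes of v.               *)
Definition edges (t : ptree) : {fset seq nat} :=
  [fset v in vertices t | v != [::]].

Definition admissible (t : ptree) (c : {fset seq nat}) : bool :=
  all (fun l => count (fun e => prefix e l) c <= 1)%N (leaves t).

(* The component of the root after removal of the edges satisfying c. *)
Fixpoint prune (t : ptree) (c : pred (seq nat)) : ptree :=
  let: PNode s := t in
  PNode [seq nth (fun=> pleaf) (map prune s) i (fun p => c (i :: p))
        | i <- iota 0 (size s) & ~~ c [:: i]].

(* The component of t minus c whose vertex closest to the root is v. *)
Definition component (t : ptree) (c : {fset seq nat}) (v : seq nat) : tree :=
  of_planar (prune (subtree t v) (fun p => v ++ p \in c)).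

Notation forest := {cmonom tree}.

Definition cut_root (t : ptree) (c : {fset seq nat}) : tree :=
  component t c [::].

Definition cut_forest (t : ptree) (c : {fset seq nat}) : forest :=
  \big[mmul/mone]_(e <- c) ucm (component t c e).

Definition corolla (n : nat) : tree := of_planar (PNode (nseq n.-1 pleaf)).

(* ** Pairs of monomials: the monomial basis of a tensor product *)

Section PairMonomial.
Variables M N : conomType.
Implicit Types x y z : (M * N)%type.

Definition pair_mul x y : M * N := (mmul x.1 y.1, mmul x.2 y.2).

Lemma pair_mulA : associative pair_mul.
Proof. by move=> x y z; rewrite /pair_mul /= !mulmA. Qed.

Lemma pair_mul1m : left_id (mone, mone) pair_mul.
Proof. by case=> a b; rewrite /pair_mul /= !mul1m. Qed.

Lemma pair_mulm1 : right_id (mone, mone) pair_mul.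
Proof. by case=> a b; rewrite /pair_mul /= !mulm1. Qed.

Lemma pair_unitm x y :
  pair_mul x y = (mone, mone) -> x = (mone, mone) /\ y = (mone, mone).
Proof.
by case: x y => [a b] [a' b'] [] /unitm[-> ->] /unitm[-> ->].
Qed.

Lemma pair_mulC : commutative pair_mul.
Proof.
by move=> x y; rewrite /pair_mul (mulmC x.1) (mulmC x.2).
Qed.

HB.instance Definition _ := Choice_isMonomialDef.Build (M * N)%type
  pair_mulA pair_mul1m pair_mulm1 pair_unitm.
HB.instance Definition _ :=
  MonomialDef_isConomialDef.Build (M * N)%type pair_mulC.

End PairMonomial.

(* ** The Connes-Kreimer Hopf algebra *)

Notation HCK K := {malg K[forest]}.
Notation HCK2 K := {malg K[(forest * forest)%type]}.

Section ConnesKreimer.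
Variable K : fieldType.

Local Notation HCK := (HCK K).
Local Notation HCK2 := (HCK2 K).

Definition tens (x y : HCK) : HCK2 :=
  \sum_(m <- msupp x) \sum_(n <- msupp y) << x@_m * y@_n *g (m, n) >>.

Definition tvar (T : tree) : HCK := << ucm T >>.

Definition coprod_tree (T : tree) : HCK2 :=
  tens (tvar T) 1 + tens 1 (tvar T)
  + \sum_(c <- fpowerset (edges T) | admissible T c && (c != fset0))
      tens << cut_forest T c >> (tvar (cut_root T c)).

Definition coprod_forest (F : forest) : HCK2 :=
  \prod_(T <- finsupp F) coprod_tree T ^+ F T.

Definition coprod (x : HCK) : HCK2 :=
  \sum_(F <- msupp x) x@_F *: coprod_forest F.

Definition counit (x : HCK) : K := x@_mone.

(* The convolution product m o (f (x) g) o coprod. *)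
Definition convolution (f g : HCK -> HCK) (x : HCK) : HCK :=
  \sum_(p <- msupp (coprod x)) (coprod x)@_p *: (f << p.1 >> * g << p.2 >>).

Definition is_antipode (S : {linear HCK -> HCK}) : Prop :=
  forall x, convolution S id x = (counit x)%:A
         /\ convolution id S x = (counit x)%:A.

Definition subalgebra (A : HCK -> Prop) : Prop :=
  [/\ A 1,
      (forall x y, A x -> A y -> A (x + y)),
      (forall (a : K) x, A x -> A (a *: x)) &
      (forall x y, A x -> A y -> A (x * y))].

Definition tensor_square (A : HCK -> Prop) (z : HCK2) : Prop :=
  exists2 s : seq (HCK * HCK),
    (forall p, p \in s -> A p.1 /\ A p.2)
    & z = \sum_(p <- s) tens p.1 p.2.

(* The antipode is unique, so quantifying over S names the antipode of HCK. *)
Definition Hopf_subalgebra (A : HCK -> Prop) : Prop :=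
  [/\ subalgebra A,
      (forall x, A x -> tensor_square A (coprod x)) &
      (forall S, is_antipode S -> forall x, A x -> A (S x))].

(* Sequences (t_n), n >= 1, are functions on nat whose value at 0 is never *)
(* used; likewise for arrays indexed by i, j >= 1.                         *)
Implicit Types (t : nat -> HCK) (lam : nat -> nat -> K).

Definition generated t (x : HCK) : Prop :=
  forall A, subalgebra A -> (forall n, (0 < n)%N -> A (t n)) -> A x.

Definition tree_combination (n : nat) (x : HCK) : Prop :=
  forall F, F \in msupp x -> exists2 T : tree, F = ucm T & nvertices T = n.

Definition in_Seq t : Prop :=
  [/\ (forall n, (0 < n)%N -> t n != 0 /\ tree_combination n (t n)),
      t 1%N = tvar (of_planar pleaf) &
      Hopf_subalgebra (generated t)].

(* Monomials in the t_n; the exponent of t_(k+1) is m k. *)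
Definition seq_monomial t (m : {cmonom nat}) : HCK :=
  \prod_(k <- finsupp m) t k.+1 ^+ m k.

(* Q lists the coordinates of coprod (t_(i+j)) on tensors of monomials in   *)
(* the t_n; its coefficient at (ucm j.-1, ucm i.-1) is that of t_j (x) t_i. *)
Definition Lambda_array t lam : Prop :=
  forall i j, (0 < i)%N -> (0 < j)%N ->
  exists2 Q : {malg K[({cmonom nat} * {cmonom nat})%type]},
    coprod (t (i + j)%N) =
      \sum_(p <- msupp Q)
        Q@_p *: tens (seq_monomial t p.1) (seq_monomial t p.2)
    & lam i j = Q@_(ucm j.-1, ucm i.-1).

(* size p is the degree of p plus one, and size 0 = 0. *)
Definition strong_order (k : nat) lam : Prop :=
  (forall j, (0 < j)%N -> exists2 p : {poly K},
      (size p <= k.+1)%N & forall i, (0 < i)%N -> lam i j = p.[i%:R])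
  /\ (exists2 p : {poly K},
      size p = k.+1 & forall i, (0 < i)%N -> lam i 1%N = p.[i%:R]).

End ConnesKreimer.

(* Main.v *)
Require Import Defs.
From mathcomp Require Import zify ring.
Import GRing.Theory.
Local Open Scope fset_scope.
Local Open Scope ring_scope.
Set Implicit Arguments.
Unset Strict Implicit.
Unset Printing Implicit Defensive.

(* Comparing the coefficients of A (x) B, for trees A and B, on both sides of *)
(* the expansion of Delta(t_(i+j)) shows that T |-> (coefficient of T) turns  *)
(* the grafting product of trees, dual to cutting a single edge, into the     *)
(* product e_i . e_j = lam i j e_(i+j). The pre-Lie identity for trees thus   *)
(* gives lam i j lam (i+j) k - lam j k lam i (j+k) symmetric in j and k. Take *)
(* j = 1 and suppose lam _ k is a nonzero polynomial with k >= 2: comparing   *)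
(* leading terms, lam _ (k+1) has larger degree, because l >= 2. The degrees  *)
(* being at most l, lam i k = 0 for all k >= 2. If T has a child subtree A    *)
(* with at least two vertices and T \ A = B, the vanishing of the coefficient *)
(* of A (x) B kills the coefficient of T in t_n, by induction on the number   *)
(* of children of the root: the other trees contributing to A (x) B are       *)
(* obtained by grafting A on B away from the root.                            *)

(** A product of two or more of the t_n contains no single tree, so the array is determined by the
    terms tree (x) tree of Delta. On a tree these come from the cuts of one edge, counted by [ncuts]
    ([mcoeff_coprod_tree]), which gives [Lambda_ncuts]. Counting pairs of non-nested edges in either
    order ([forest_cuts_preLie], [ncuts_preLie]) yields the quadratic relation [Lambda_preLie].

    Let P, q, r be the polynomials of lam _ 1, lam _ k, lam _ (k+1), with k >= 2. For j = 1 the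
    relation reads P(X) q(X+1) - q(X) P(X+k) = c r(X) with a scalar c. If q is nonzero, the left
    side has degree at least l + deg q - 1 > deg q ([size_shift_commutator]), hence so has r;
    repeating this exceeds the bound l. So lam i k = 0 for k >= 2 ([strong_order_Lambda_eq0]), and
    only corollas survive in t_n ([mcoeff_noncorolla]). Conversely, an edge of a corolla detaches a
    single vertex, whence lam i j = 0 for j >= 2 ([Lambda_corolla]). *)

(* One pair (branch cut off, remaining trunk) per edge. In a forest, an edge  *)
(* above each root is included.                                               *)
Section ForestCuts.
Variable cuts : ptree -> seq (ptree * ptree).

Fixpoint forest_cuts_with (s : seq ptree) : seq (ptree * seq ptree) :=
  if s is u :: s' then
    (u, s') :: [seq (p.1, p.2 :: s') | p <- cuts u]
            ++ [seq (p.1, u :: p.2) | p <- forest_cuts_with s']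
  else [::].

End ForestCuts.

Fixpoint tree_cuts (t : ptree) : seq (ptree * ptree) :=
  let: PNode s := t in
  [seq (p.1, PNode p.2) | p <- forest_cuts_with tree_cuts s].

Notation forest_cuts := (forest_cuts_with tree_cuts).

(** Read as the children of its first tree together with the remaining trees, a forest is a binary
    tree; [forest_cuts] recurses in the same way. *)
Lemma pforest_ind (P : seq ptree -> Prop) :
  P [::] -> (forall s1 s2, P s1 -> P s2 -> P (PNode s1 :: s2)) ->
  forall s, P s.
Proof.
move=> P0 PS.
suff Pt t : P (pchildren t) by elim=> [|[s1] s2 IH] //; apply: PS (Pt (PNode s1)) IH.
elim/ptree_seq_ind: t => s /=; elim: s => [|[s1] s2 IHs] //= IH.
apply: PS; first exact: (IH 0%N).
by apply: IHs => i lt_i; apply: (IH i.+1).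
Qed.

Section CutSums.
Variable V : nmodType.

Lemma big_tree_cuts (F : ptree * ptree -> V) t :
  \sum_(p <- tree_cuts t) F p
  = \sum_(p <- forest_cuts (pchildren t)) F (p.1, PNode p.2).
Proof. by case: t => s; rewrite big_map. Qed.

Lemma big_forest_cuts_cons (F : ptree * seq ptree -> V) s1 s2 :
  \sum_(p <- forest_cuts (PNode s1 :: s2)) F p
  = F (PNode s1, s2) + (\sum_(p <- forest_cuts s1) F (p.1, PNode p.2 :: s2)
  + \sum_(p <- forest_cuts s2) F (p.1, PNode s1 :: p.2)).
Proof.
by rewrite /= big_cons big_cat /= !big_map.
Qed.

Lemma big_forest_cuts_nil (F : ptree * seq ptree -> V) :
  \sum_(p <- forest_cuts [::]) F p = 0.
Proof. by rewrite big_nil. Qed.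

Lemma big_forest_cuts_cat (F : ptree * seq ptree -> V) s1 s2 :
  \sum_(p <- forest_cuts (s1 ++ s2)) F p
  = \sum_(p <- forest_cuts s1) F (p.1, p.2 ++ s2)
  + \sum_(p <- forest_cuts s2) F (p.1, s1 ++ p.2).
Proof.
elim: s1 F => [|[s] s1 IH] F.
  by rewrite big_forest_cuts_nil add0r; apply: eq_bigr => -[].
rewrite cat_cons !big_forest_cuts_cons IH /= !addrA; congr (_ + _ + _ + _).
Qed.

Lemma big_forest_cuts_nth (F : ptree * seq ptree -> V) s :
  \sum_(p <- forest_cuts s) F p
  = \sum_(0 <= i < size s)
      (F (nth pleaf s i, take i s ++ drop i.+1 s)
       + \sum_(p <- tree_cuts (nth pleaf s i))
            F (p.1, take i s ++ p.2 :: drop i.+1 s)).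
Proof.
elim: s F => [|[s1] s2 IH] F; first by rewrite big_forest_cuts_nil big_nil.
rewrite big_forest_cuts_cons [size _]/= big_nat_recl //= drop0 !big_map addrA.
by congr (_ + _); rewrite IH.
Qed.

End CutSums.

(* The pre-Lie identity, dualized: a pair of successive cuts which are not   *)
(* nested can be performed in either order.                                  *)
Lemma forest_cuts_preLie (V : comNzRingType) (F : ptree -> ptree -> seq ptree -> V) s :
  let L F s := \sum_(p <- forest_cuts s) \sum_(q <- forest_cuts p.2)
                  F p.1 q.1 q.2 in
  let M F s := \sum_(p <- forest_cuts s) \sum_(q <- tree_cuts p.1)
                  F q.1 q.2 p.2 in
  let F' := fun a b r => F b a r in
  L F s - M F s = L F' s - M F' s.
Proof.
move=> L M /=.
(* The first two sums are symmetric in the first two arguments of [G]. The third, where a branch of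
   the first tree is cut and then the rest of that tree is removed, recurs in [Mc] and cancels in
   the difference. The remaining terms are left to the induction hypotheses. *)
have Lc G s1 s2 : L G (PNode s1 :: s2) =
    (\sum_(p <- forest_cuts s2) (G (PNode s1) p.1 p.2 + G p.1 (PNode s1) p.2))
    + ((\sum_(p <- forest_cuts s1) \sum_(q <- forest_cuts s2)
         (G p.1 q.1 (PNode p.2 :: q.2) + G q.1 p.1 (PNode p.2 :: q.2)))
    + \sum_(p <- forest_cuts s1) G p.1 (PNode p.2) s2)
    + (L (fun a b r => G a b (PNode r :: s2)) s1
       + L (fun a b r => G a b (PNode s1 :: r)) s2).
  rewrite /L big_forest_cuts_cons /=.
  have -> : \sum_(p <- forest_cuts s1)
      \sum_(q <- forest_cuts (PNode p.2 :: s2)) G p.1 q.1 q.2 =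
     \sum_(p <- forest_cuts s1) (G p.1 (PNode p.2) s2 +
      (\sum_(q <- forest_cuts p.2) G p.1 q.1 (PNode q.2 :: s2) +
       \sum_(q <- forest_cuts s2) G p.1 q.1 (PNode p.2 :: q.2))).
    by apply: eq_bigr => p _; rewrite big_forest_cuts_cons.
  have -> : \sum_(p <- forest_cuts s2)
      \sum_(q <- forest_cuts (PNode s1 :: p.2)) G p.1 q.1 q.2 =
     \sum_(p <- forest_cuts s2) (G p.1 (PNode s1) p.2 +
      (\sum_(q <- forest_cuts s1) G p.1 q.1 (PNode q.2 :: p.2) +
       \sum_(q <- forest_cuts p.2) G p.1 q.1 (PNode s1 :: q.2))).
    by apply: eq_bigr => p _; rewrite big_forest_cuts_cons.
  rewrite !big_split /=.
  have -> : \sum_(p <- forest_cuts s2) \sum_(q <- forest_cuts s1)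
         G p.1 q.1 (PNode q.2 :: p.2)
    = \sum_(p <- forest_cuts s1) \sum_(q <- forest_cuts s2)
         G q.1 p.1 (PNode p.2 :: q.2) by rewrite exchange_big.
  have -> : \sum_(p <- forest_cuts s1) \sum_(q <- forest_cuts s2)
         (G p.1 q.1 (PNode p.2 :: q.2) + G q.1 p.1 (PNode p.2 :: q.2))
    = \sum_(p <- forest_cuts s1) \sum_(q <- forest_cuts s2)
         G p.1 q.1 (PNode p.2 :: q.2)
    + \sum_(p <- forest_cuts s1) \sum_(q <- forest_cuts s2)
         G q.1 p.1 (PNode p.2 :: q.2).
    by rewrite -big_split; apply: eq_bigr => p _; rewrite big_split.
  ring.
have Mc G s1 s2 : M G (PNode s1 :: s2) =
    \sum_(p <- forest_cuts s1) G p.1 (PNode p.2) s2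
    + (M (fun a b r => G a b (PNode r :: s2)) s1
       + M (fun a b r => G a b (PNode s1 :: r)) s2).
  by rewrite /M big_forest_cuts_cons big_tree_cuts.
elim/pforest_ind: s F => [|s1 s2 IH1 IH2] F.
  by rewrite /L /M !big_forest_cuts_nil.
have := IH1 (fun a b r => F a b (PNode r :: s2)).
have := IH2 (fun a b r => F a b (PNode s1 :: r)).
rewrite !Lc !Mc.
have -> : \sum_(p <- forest_cuts s2) (F (PNode s1) p.1 p.2 + F p.1 (PNode s1) p.2)
  = \sum_(p <- forest_cuts s2) (F p.1 (PNode s1) p.2 + F (PNode s1) p.1 p.2).
  by apply: eq_bigr => p _; rewrite addrC.
have -> : \sum_(p <- forest_cuts s1) \sum_(q <- forest_cuts s2)
         (F p.1 q.1 (PNode p.2 :: q.2) + F q.1 p.1 (PNode p.2 :: q.2))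
  = \sum_(p <- forest_cuts s1) \sum_(q <- forest_cuts s2)
         (F q.1 p.1 (PNode p.2 :: q.2) + F p.1 q.1 (PNode p.2 :: q.2)).
  by apply: eq_bigr => p _; apply: eq_bigr => q _; rewrite addrC.
move=> /(canRL (subrK _)) -> /(canRL (subrK _)) ->.
ring.
Qed.

(** * Invariance under reordering of siblings *)

Definition forest_equiv (s s' : seq ptree) : bool :=
  perm_eq (map of_planar s) (map of_planar s').

Section Invariance.
Variables (V : nmodType) (H : ptree * seq ptree -> V).

Hypothesis H_equiv : forall a a' s s',
  of_planar a = of_planar a' -> forest_equiv s s' -> H (a, s) = H (a', s').

(** It suffices to swap two adjacent blocks, which only reorders the forest left by each cut. *)
Lemma big_forest_cuts_perm s s' : perm_eq s s' ->
  \sum_(p <- forest_cuts s) H p = \sum_(p <- forest_cuts s') H p.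
Proof.
pose P r := \sum_(p <- forest_cuts s) H p = \sum_(p <- forest_cuts r) H p.
move=> h; apply: (catCA_perm_ind (P := P) _ h) => // s1 s2 s3; rewrite /P => ->.
rewrite !big_forest_cuts_cat /= addrCA.
congr (_ + (_ + _)); apply: eq_bigr => -[a r] _ /=; apply: H_equiv => //.
all: rewrite /forest_equiv !map_cat; apply/permP => f; rewrite !count_cat; lia.
Qed.

End Invariance.

(** Normalization sorts siblings at every vertex: the sort at one level is undone by
    [big_forest_cuts_perm], the deeper ones by induction. Counts of cuts thereby make sense for
    non-planar trees. *)
Lemma big_forest_cuts_normalize (V : nmodType) (H : ptree * seq ptree -> V) s :
  (forall a a' s s', of_planar a = of_planar a' -> forest_equiv s s' ->
    H (a, s) = H (a', s')) ->
  \sum_(p <- forest_cuts (map normalize s)) H p = \sum_(p <- forest_cuts s) H p.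
Proof.
have normE u : of_planar (normalize u) = of_planar u.
  by apply: val_inj; apply/eqP; apply: normalizeK.
have normsE r : map of_planar (map normalize r) = map of_planar r.
  by rewrite -map_comp; apply: eq_map => u /=; apply: normE.
elim/pforest_ind: s H => // s1 s2 IH1 IH2 H H_equiv.
rewrite map_cons [normalize _]/= !big_forest_cuts_cons; congr (_ + (_ + _)).
- apply: H_equiv; last by rewrite /forest_equiv normsE.
  exact: (normE (PNode s1)).
- rewrite -(@big_forest_cuts_perm _ _ _ (map normalize s1)); last 2 first.
  + move=> a a' r r' eq_a eq_r; apply: H_equiv => //.
    by rewrite /forest_equiv /= !normsE; move/of_planarP: eq_r => ->; apply: perm_refl.
  + by rewrite perm_sym perm_sort.
  rewrite IH1 => [|a a' r r' eq_a eq_r]; last first.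
    apply: H_equiv => //.
    by rewrite /forest_equiv /= !normsE; move/of_planarP: eq_r => ->; apply: perm_refl.
  apply: eq_bigr => -[a r] _; apply: H_equiv => //.
  by rewrite /forest_equiv /= normsE; apply: perm_refl.
- rewrite IH2 => [|a a' r r' eq_a eq_r]; last first.
    by apply: H_equiv => //; rewrite /forest_equiv /= perm_cons.
  apply: eq_bigr => -[a r] _; apply: H_equiv => //.
  rewrite /forest_equiv /=; have /= -> := normE (PNode s1); exact: perm_refl.
Qed.

(** * Counting the cuts with given branch and trunk *)

Definition ncuts (A B : tree) (t : ptree) : nat :=
  (\sum_(p <- tree_cuts t) ((of_planar p.1 == A) && (of_planar p.2 == B)))%N.

Lemma ncuts_neq0 A B t : ncuts A B t != 0%N ->
  exists2 p, p \in tree_cuts t & of_planar p.1 = A /\ of_planar p.2 = B.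
Proof.
move=> cuts0; have /hasP[p pt /andP[/eqP pA /eqP pB]] : has (fun p =>
    (of_planar p.1 == A) && (of_planar p.2 == B)) (tree_cuts t); last by exists p.
by apply: contraNT cuts0 => /hasPn h; rewrite /ncuts big_seq big1 // => p /h /negPf ->.
Qed.

Lemma ncuts_of_planar A B t : ncuts A B (of_planar t) = ncuts A B t.
Proof.
case: t => s; rewrite /ncuts !big_tree_cuts /=.
rewrite -(@big_forest_cuts_normalize _ _ s); last first.
  by move=> a a' r r' /= -> /of_planarP ->.
apply/esym/big_forest_cuts_perm; first by move=> a a' r r' /= -> /of_planarP ->.
by rewrite perm_sym perm_sort.
Qed.

Lemma nvertices_PNode s : nvertices (PNode s) = (sumn (map nvertices s)).+1.
Proof.
rewrite /nvertices /= size_allpairs_dep -[in RHS](mkseq_nth pleaf s) -map_comp.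
congr (sumn _).+1; apply/eq_in_map => i; rewrite mem_iota => lt_i.
by rewrite (nth_map pleaf).
Qed.

Lemma nvertices_of_planar t : nvertices (of_planar t) = nvertices t.
Proof.
elim/ptree_seq_ind: t => s IH; rewrite !nvertices_PNode; congr _.+1.
transitivity (sumn (map nvertices (map normalize s))).
  by apply/perm_sumn/perm_map; rewrite perm_sort.
rewrite -map_comp; congr sumn; apply/eq_in_map => u /(nthP pleaf)[i lt_i <-]; exact: IH.
Qed.

Lemma nvertices_gt0 t : (0 < nvertices t)%N.
Proof. by case: t => s; rewrite nvertices_PNode. Qed.

Lemma forest_cuts_nvertices s p : p \in forest_cuts s ->
  (nvertices p.1 + sumn (map nvertices p.2) = sumn (map nvertices s))%N.
Proof.
elim/pforest_ind: s p => [|s1 s2 IH1 IH2] p //=.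
rewrite inE mem_cat => /or3P[/eqP-> //|/mapP[_ /mapP[q q_in ->] ->]|/mapP[q q_in ->]] /=.
  by rewrite !nvertices_PNode -(IH1 q) // addnA addnS.
by rewrite -(IH2 q) // addnCA.
Qed.

Lemma tree_cuts_nvertices t p : p \in tree_cuts t ->
  (nvertices p.1 + nvertices p.2 = nvertices t)%N.
Proof.
case: t => s /mapP[q /forest_cuts_nvertices q_in ->] /=.
by rewrite !nvertices_PNode -q_in addnS.
Qed.

Lemma ncuts_nvertices A B (T : tree) : ncuts A B T != 0%N ->
  (nvertices A + nvertices B)%N = nvertices T.
Proof.
move=> /ncuts_neq0[p pT [<- <-]].
by rewrite !nvertices_of_planar (tree_cuts_nvertices pT).
Qed.

(** * Pruning at one edge, and the enumeration of edges by vertices *)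

Lemma eq_prune t c c' : c =1 c' -> prune t c = prune t c'.
Proof.
elim/ptree_seq_ind: t c c' => s IH c c' eq_c /=; congr PNode.
rewrite (eq_filter (a2 := fun i => ~~ c' [:: i])); last by move=> i; rewrite eq_c.
apply/eq_in_map => i; rewrite mem_filter mem_iota => /andP[_ lt_i].
by rewrite !(nth_map pleaf) //; apply: IH => // p; apply: eq_c.
Qed.

Lemma prune_PNode s c : prune (PNode s) c =
  PNode [seq prune (nth pleaf s i) (fun p => c (i :: p))
        | i <- iota 0 (size s) & ~~ c [:: i]].
Proof.
congr PNode; apply/eq_in_map => i; rewrite mem_filter mem_iota => /andP[_ lt_i].
by rewrite (nth_map pleaf).
Qed.

Lemma prune_id t c : (forall p, p != [::] -> ~~ c p) -> prune t c = t.
Proof.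
elim/ptree_seq_ind: t c => s IH c c0; rewrite prune_PNode; congr PNode.
rewrite (eq_filter (a2 := predT)) ?filter_predT; last by move=> i; rewrite c0.
rewrite -[RHS](mkseq_nth pleaf); apply/eq_in_map => i; rewrite mem_iota => lt_i.
by apply: IH => // p _; apply: c0.
Qed.

Lemma prune_cons s i v : (i < size s)%N ->
  prune (PNode s) (pred1 (i :: v)) =
  PNode (take i s ++
         (if v == [::] then [::] else [:: prune (nth pleaf s i) (pred1 v)])
         ++ drop i.+1 s).
Proof.
move=> lt_i; rewrite prune_PNode; congr PNode.
have other r : i \notin r ->
    [seq prune (nth pleaf s j) (fun p => pred1 (i :: v) (j :: p))
    | j <- r & ~~ pred1 (i :: v) [:: j]] = [seq nth pleaf s j | j <- r].
  move=> ir; rewrite (eq_in_filter (a2 := predT)); last first.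
    by move=> j jr /=; rewrite eqseq_cons (negPf (memPn ir j jr)).
  rewrite filter_predT; apply/eq_in_map => j jr; apply: prune_id => p _ /=.
  by rewrite eqseq_cons (negPf (memPn ir j jr)).
have -> : iota 0 (size s) = iota 0 i ++ [:: i] ++ iota i.+1 (size s - i.+1).
  by rewrite -[X in iota _ X](subnKC lt_i) -addn1 -addnA iotaD iotaD /= addn1.
rewrite !filter_cat !map_cat.
rewrite (other (iota 0 i)) ?mem_iota ?ltnn ?andbF //.
rewrite (other (iota i.+1 _)) ?mem_iota ?ltnn //.
rewrite map_nth_iota0 ?(ltnW lt_i) // map_nth_iota ?subnKC //.
rewrite [in take (size s - _) _]take_oversize ?size_drop //.
congr (_ ++ (_ ++ _)) => /=; rewrite eqseq_cons eqxx eq_sym /=.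
case: (v == [::]) => //=; congr (_ :: _); apply: eq_prune => p /=.
by rewrite eqseq_cons eqxx.
Qed.

Lemma vertices_uniq t : uniq (vertices t).
Proof.
elim/ptree_seq_ind: t => s IH; rewrite [vertices _]/= cons_uniq; apply/andP; split.
  by apply/allpairsPdep => -[i [p []]].
apply: allpairs_uniq_dep; first exact: iota_uniq.
  by move=> i; rewrite mem_iota => lt_i; rewrite (nth_map pleaf) //; apply: IH.
by move=> [i p] [j q] _ _ /= [-> ->].
Qed.

Lemma big_vertices (V : nmodType) (F : seq nat -> V) t :
  \sum_(v <- vertices t) F v = F [::] + \sum_(v <- vertices t | v != [::]) F v.
Proof.
case: t => s; rewrite [vertices _]/= !big_cons /=; congr (_ + _).
by rewrite [in RHS]big_mkcond !big_allpairs_dep.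
Qed.

(** Bridge from edges named by vertices, as in the coproduct, to the recursive enumeration: the path
    [[:: i]] is the edge above child [i], and longer paths through [i] are the edges inside that
    child. *)
Lemma big_vertices_cuts (V : nmodType) (F : ptree * ptree -> V) t :
  \sum_(v <- vertices t | v != [::]) F (subtree t v, prune t (pred1 v))
  = \sum_(p <- tree_cuts t) F p.
Proof.
elim/ptree_seq_ind: t F => s IH F; rewrite big_tree_cuts big_forest_cuts_nth.
pose G v := F (subtree (PNode s) v, prune (PNode s) (pred1 v)).
rewrite -[LHS]/(\sum_(v <- vertices (PNode s) | v != [::]) G v).
rewrite [vertices _]/= big_mkcond big_cons /= add0r big_allpairs_dep /= /index_iota subn0.
rewrite [LHS]big_seq_cond [RHS]big_seq_cond; apply: eq_bigr => i.
rewrite andbT mem_iota => /= lt_i; rewrite (nth_map pleaf) // big_vertices /=.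
rewrite {1}/G prune_cons //=; congr (_ + _).
rewrite -(IH i lt_i (fun p => F (p.1, PNode (take i s ++ p.2 :: drop i.+1 s)))).
by apply: eq_bigr => v v0; rewrite /G prune_cons // (negPf v0).
Qed.

(** * The pre-Lie identity for non-planar trees *)

Section NcutsPreLie.
Variable R : comNzRingType.

Lemma big_fset_delta (I : choiceType) (D : {fset I}) (f : I -> R) x : x \in D ->
  \sum_(y <- D) (x == y)%:R * f y = f x.
Proof.
move=> xD; rewrite (big_fsetD1 x) //= eqxx mul1r big_seq big1 ?addr0 // => y.
by rewrite !inE eq_sym => /andP[/negPf-> _]; rewrite mul0r.
Qed.

Lemma ncutsE A B t : (ncuts A B t)%:R =
  \sum_(p <- tree_cuts t) (of_planar p.1 == A)%:R * (of_planar p.2 == B)%:R :> R.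
Proof.
by rewrite /ncuts natr_sum; apply: eq_bigr => p _; rewrite -natrM mulnb.
Qed.

(** [D] stands in for the set of all trees: it makes sums over an intermediate tree finite, and
    nothing is lost once it holds every branch and trunk of [t]. *)
Variables (D : {fset tree}) (t : ptree).
Hypothesis cuts_in_D : forall p, p \in tree_cuts t ->
  (of_planar p.1 \in D) && (of_planar p.2 \in D).

Lemma sum_ncuts_trunk (f : tree -> R) C :
  \sum_(T <- D) (ncuts C T t)%:R * f T
  = \sum_(p <- tree_cuts t) (of_planar p.1 == C)%:R * f (of_planar p.2).
Proof.
under eq_bigr => T _ do rewrite ncutsE mulr_suml.
rewrite exchange_big /= [LHS]big_seq [RHS]big_seq; apply: eq_bigr => p /cuts_in_D.
move=> /andP[_ p2]; rewrite -(big_fset_delta f p2) mulr_sumr.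
by apply: eq_bigr => T _; rewrite mulrA.
Qed.

Lemma sum_ncuts_branch (f : tree -> R) B :
  \sum_(T <- D) (ncuts T B t)%:R * f T
  = \sum_(p <- tree_cuts t) (of_planar p.2 == B)%:R * f (of_planar p.1).
Proof.
under eq_bigr => T _ do rewrite ncutsE mulr_suml.
rewrite exchange_big /= [LHS]big_seq [RHS]big_seq; apply: eq_bigr => p /cuts_in_D.
move=> /andP[p1 _]; rewrite -(big_fset_delta f p1) mulr_sumr.
by apply: eq_bigr => T _; rewrite mulrCA mulrA.
Qed.

(** On the left, the first sum counts the ways to detach C and then A, leaving B; the second counts
    those where C is cut out of the branch that leaves A. The difference counts pairs of non-nested
    edges, which is symmetric in A and C. *)
Lemma ncuts_preLie A B C :
  \sum_(T <- D) (ncuts C T t)%:R * (ncuts A B T)%:R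
  - \sum_(T <- D) (ncuts T B t)%:R * (ncuts C A T)%:R
  = \sum_(T <- D) (ncuts A T t)%:R * (ncuts C B T)%:R
  - \sum_(T <- D) (ncuts T B t)%:R * (ncuts A C T)%:R :> R.
Proof.
have H X Y : 
  \sum_(T <- D) (ncuts X T t)%:R * (ncuts Y B T)%:R
  - \sum_(T <- D) (ncuts T B t)%:R * (ncuts X Y T)%:R =
  (\sum_(p <- forest_cuts (pchildren t)) \sum_(q <- forest_cuts p.2)
     (of_planar p.1 == X)%:R * (of_planar q.1 == Y)%:R
       * (of_planar (PNode q.2) == B)%:R) -
  \sum_(p <- forest_cuts (pchildren t)) \sum_(q <- tree_cuts p.1)
     (of_planar q.1 == X)%:R * (of_planar q.2 == Y)%:R
       * (of_planar (PNode p.2) == B)%:R :> R.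
  rewrite (sum_ncuts_trunk (fun T => (ncuts Y B T)%:R)).
  rewrite (sum_ncuts_branch (fun T => (ncuts X Y T)%:R)) !big_tree_cuts.
  congr (_ - _); apply: eq_bigr => p _; rewrite ncuts_of_planar ncutsE.
    rewrite big_tree_cuts mulr_sumr; apply: eq_bigr => q _; exact: mulrA.
  by rewrite mulrC mulr_suml.
rewrite !H.
pose F a b r : R := (of_planar a == C)%:R * (of_planar b == A)%:R
  * (of_planar (PNode r) == B)%:R.
have := forest_cuts_preLie F (pchildren t); rewrite /F => ->.
by congr (_ - _); apply: eq_bigr => p _; apply: eq_bigr => q _; rewrite [_ * (_ == A)%:R]mulrC.
Qed.

End NcutsPreLie.

(** * Coefficients of the coproduct on pairs of trees *)

Section Coproduct.
Variable K : fieldType.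

Lemma mcoeff_tens (x y : HCK K) m n : (tens x y)@_(m, n) = x@_m * y@_n.
Proof.
rewrite /tens raddf_sum /=.
under eq_bigr => k _ do rewrite raddf_sum /=.
under eq_bigr => k _ do under eq_bigr => l _ do rewrite mcoeffU xpair_eqE.
transitivity ((\sum_(k <- msupp x) x@_k *+ (k == m)) *
   (\sum_(l <- msupp y) y@_l *+ (l == n))).
  rewrite mulr_suml; apply: eq_bigr => k _; rewrite mulr_sumr; apply: eq_bigr => l _.
  by case: (k == m); case: (l == n); rewrite ?mulr0n ?mul0r ?mulr0.
have E (z : HCK K) q : \sum_(k <- msupp z) z@_k *+ (k == q) = z@_q.
  by rewrite [in RHS](monalgE z) raddf_sum; apply: eq_bigr => k _; rewrite /= mcoeffU.
by rewrite !E.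
Qed.

Lemma mcoeff_coprod (x : HCK K) p :
  (coprod x)@_p = \sum_(F <- msupp x) x@_F * (coprod_forest K F)@_p.
Proof. by rewrite raddf_sum; apply: eq_bigr => F _; rewrite /= mcoeffZ. Qed.

Lemma coprod_forest_ucm T : coprod_forest K (ucm T) = coprod_tree K T.
Proof. by rewrite /coprod_forest mdomU big_seq_fset1 cmUU expr1. Qed.

Lemma ucm_inj (I : choiceType) : injective (@ucm I).
Proof.
move=> i j /(congr1 (fun m : {cmonom I} => m j)); rewrite !cmU eqxx.
by case: eqP.
Qed.

Lemma mdeg_cut_forest (t : ptree) c : mdeg (cut_forest t c) = #|` c|.
Proof.
rewrite /cut_forest mdeg_prod (eq_bigr (fun=> 1%N)) => [|e _]; last exact: mdegU.
by rewrite sum1_size.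
Qed.

Lemma cut_forest1 (t : ptree) e : cut_forest t [fset e] = ucm (of_planar (subtree t e)).
Proof.
rewrite /cut_forest big_seq_fset1 /component prune_id // => p p0.
apply/negP; rewrite inE -[X in _ == X]cats0.
by rewrite eqseq_cat // eqxx (negPf p0).
Qed.

Lemma cut_root1 (t : ptree) e : cut_root t [fset e] = of_planar (prune t (pred1 e)).
Proof.
by rewrite /cut_root /component; congr of_planar; apply: eq_prune => p; rewrite /= inE.
Qed.

(** A cut with m edges yields a forest of m trees, so only one-edge cuts, all admissible, have a
    single tree on the left. The terms T (x) 1 and 1 (x) T do not contribute, since 1 is not a
    tree. *)
Lemma mcoeff_coprod_tree (A B T : tree) :
  (coprod_tree K T)@_(ucm A, ucm B) = (ncuts A B T)%:R.
Proof.
have U0 (I : tree) : (1 : HCK K)@_(ucm I) = 0 by rewrite mcoeff1 cm1_eq1.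
pose G c : K := (tens << cut_forest T c >> (tvar K (cut_root T c)))@_(ucm A, ucm B).
have l0 : (tens (tvar K T) 1)@_(ucm A, ucm B) = 0 by rewrite mcoeff_tens [X in _ * X]U0 mulr0.
have r0 : (tens 1 (tvar K T))@_(ucm A, ucm B) = 0 by rewrite mcoeff_tens [X in X * _]U0 mul0r.
transitivity (\sum_(c <- fpowerset (edges T) | admissible T c && (c != fset0)) G c).
  rewrite mcoeffD [X in X + _]mcoeffD [X in X + _ + _]l0 [X in _ + X + _]r0.
  by rewrite addr0 add0r raddf_sum.
have G0 c : #|` c| != 1%N -> G c = 0.
  move=> c1; rewrite /G mcoeff_tens mcoeffU1.
  case: (cut_forest T c =P ucm A) => [eq_c|_]; last by rewrite mul0r.
  by move: c1; rewrite -(mdeg_cut_forest T) eq_c mdegU.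
have -> : \sum_(c <- fpowerset (edges T) | admissible T c && (c != fset0)) G c
        = \sum_(c <- [fset [fset e] | e in edges T]) G c.
  rewrite big_mkcond /=; symmetry.
  transitivity (\sum_(c <- [fset [fset e] | e in edges T])
      (if admissible T c && (c != fset0) then G c else 0)); last apply: big_fset_incl.
  - rewrite [LHS]big_seq [RHS]big_seq; apply: eq_bigr => c /imfsetP[e /= eT ->].
    have -> : admissible T [fset e] && ([fset e] != fset0); last by [].
    rewrite -cardfs_eq0 cardfs1 andbT; apply/allP => l _.
    by apply: leq_trans (count_size _ _) _; rewrite cardfs1.
  - apply/fsubsetP => c /imfsetP[e /= eT ->].
    by rewrite fpowersetE fsub1set.
  - move=> c; rewrite fpowersetE => cT c_not; case: ifP => [_|//]; apply: G0.
    apply: contra c_not => /cardfs1P[e eq_c]; apply/imfsetP; exists e => //=.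
    by rewrite -fsub1set -eq_c.
rewrite big_imfset /= => [|e e' _ _]; last exact: fset1_inj.
pose H (p : ptree * ptree) : K := (of_planar p.1 == A)%:R * (of_planar p.2 == B)%:R.
rewrite ncutsE -[RHS](big_vertices_cuts H) -[RHS]big_filter.
have edgesE : perm_eq (edges T) [seq v <- vertices T | v != [::]].
  apply: uniq_perm; rewrite ?fset_uniq ?filter_uniq ?vertices_uniq // => v.
  by rewrite mem_filter !inE andbC.
rewrite (perm_big _ edgesE) /=.
apply: eq_bigr => e _; rewrite /G /H mcoeff_tens /tvar !mcoeffU1.
by rewrite cut_forest1 cut_root1 !(inj_eq (@ucm_inj _)).
Qed.

End Coproduct.

(** * Monomials in the t_n and relations in the Lambda-array *)

Section SeqMonomials.
Variable K : fieldType.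

(** The degree here is the number of trees in a forest, not the number of vertices. *)
Definition homog (d : nat) (x : HCK K) : Prop :=
  forall F, F \in msupp x -> mdeg F = d.

Lemma homog1 : homog 0 1.
Proof. move=> F; rewrite -mcoeff_neq0 mcoeff1.
by have [->|_] := eqVneq F mone; rewrite ?mdeg1 ?eqxx.
Qed.

Lemma homogM d e x y : homog d x -> homog e y -> homog (d + e) (x * y).
Proof.
move=> hx hy F /msuppM_le [F1] [F2] [/hx <- /hy <- ->]; exact: mdegM.
Qed.

Lemma homogX d x n : homog d x -> homog (n * d) (x ^+ n).
Proof.
move=> hx; elim: n => [|n IH]; first exact: homog1.
by rewrite exprS mulSn; apply: homogM.
Qed.

Lemma tree_combination_homog n x : tree_combination n x -> homog 1 x.
Proof. by move=> hx F /hx [T -> _]; apply: mdegU. Qed.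

Lemma mdeg_eq1 (I : choiceType) (m : {cmonom I}) :
  mdeg m = 1%N -> exists k, m = ucm k.
Proof.
move=> m1; have [m0|[k km]] := fset_0Vmem (finsupp m).
  by move: m1; rewrite mdegE m0 big_seq_fset0.
exists k; apply/eqP/cmP => i; rewrite cmU.
move: m1; rewrite mdegE (big_fsetD1 k) //=; have := km; rewrite -cmE_neq0.
have [<-|ki] := eqVneq k i; first by case: (m k) => [|[|r]].
have [im|] := boolP (i \in finsupp m); last first.
  by rewrite -cmE_eq0 => /eqP->.
rewrite (big_fsetD1 i) /=; last by rewrite !inE im eq_sym ki.
by case: (m k) (m i) => [|[|r]] // [|r'].
Qed.

Lemma mcoeff_sum (N : choiceType) (z : {malg K[N]}) q :
  \sum_(k <- msupp z) z@_k * (k == q)%:R = z@_q.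
Proof.
rewrite [in RHS](monalgE z) raddf_sum; apply: eq_bigr => k _.
by rewrite /= mcoeffU mulr_natr.
Qed.

Lemma big_tree_combination (D : {fset tree}) n (x : HCK K) (g : forest -> K) :
  tree_combination n x -> (forall T, ucm T \in msupp x -> T \in D) ->
  \sum_(F <- msupp x) x@_F * g F = \sum_(T <- D) x@_(ucm T) * g (ucm T).
Proof.
move=> x_comb xD.
transitivity (\sum_(F <- [fset ucm T | T in D]) x@_F * g F).
  apply: big_fset_incl => [|F _ /mcoeff_outdom ->]; last by rewrite mul0r.
  apply/fsubsetP => F Fx; have [T eF _] := x_comb F Fx.
  by rewrite eF; apply/imfsetP; exists T => //=; apply: xD; rewrite -eF.
by rewrite big_imfset //= => T T' _ _; apply: ucm_inj.
Qed.

Section LambdaArray.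
Variables (t : nat -> HCK K) (lam : nat -> nat -> K).
Hypothesis t_comb : forall n, (0 < n)%N -> tree_combination n (t n).

Lemma homog_seq_monomial m : homog (mdeg m) (seq_monomial t m).
Proof.
rewrite mdegE /seq_monomial; apply: (big_rec2 (fun d x => homog d x)).
  exact: homog1.
move=> k d x _ hx; apply: homogM => //.
by have := homogX (n := m k) (tree_combination_homog (t_comb (ltn0Sn k))); rewrite muln1.
Qed.

Lemma mcoeff_t (A : tree) n : (0 < n)%N ->
  nvertices A != n -> (t n)@_(ucm A) = 0.
Proof.
move=> n0 nA; apply/eqP; rewrite mcoeff_eq0; apply: contra nA => /(t_comb n0).
by move=> [T /ucm_inj ->] /eqP.
Qed.

(** A monomial of degree d in the t_n involves only forests of d trees, so a single tree occurs only
    for d = 1, and its number of vertices then fixes the index. The predecessor appears because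
    [ucm k] stands for t_(k+1). *)
Lemma mcoeff_seq_monomial m (A : tree) :
  (seq_monomial t m)@_(ucm A)
  = (m == ucm (nvertices A).-1)%:R * (t (nvertices A))@_(ucm A).
Proof.
have [m1|m1] := eqVneq (mdeg m) 1%N; last first.
  case: eqVneq => [eq_m|_]; first by rewrite eq_m mdegU in m1.
  rewrite mul0r; apply/eqP; rewrite mcoeff_eq0; apply: contra m1.
  by move=> /homog_seq_monomial <-; rewrite mdegU.
have [k ->] := mdeg_eq1 m1.
rewrite /seq_monomial mdomU big_seq_fset1 cmUU expr1 (inj_eq (@ucm_inj _)).
have [->|kA] := eqVneq k (nvertices A).-1.
  by rewrite mul1r prednK ?nvertices_gt0.
by rewrite mul0r mcoeff_t //; apply: contra kA => /eqP->.
Qed.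

Hypothesis lamP : Lambda_array t lam.

(** Both sides are the coefficient of A (x) B in Delta(t_(i+j)): the left tree by tree, the right
    from the expansion in monomials, where only t_j (x) t_i can contribute. *)
Lemma Lambda_ncuts (D : {fset tree}) i j (A B : tree) :
  (forall T, ucm T \in msupp (t (i + j)%N) -> T \in D) ->
  nvertices A = j -> nvertices B = i ->
  \sum_(T <- D) (t (i + j)%N)@_(ucm T) * (ncuts A B T)%:R
  = lam i j * (t j)@_(ucm A) * (t i)@_(ucm B).
Proof.
move=> tD Aj Bi.
have i0 : (0 < i)%N by rewrite -Bi nvertices_gt0.
have j0 : (0 < j)%N by rewrite -Aj nvertices_gt0.
have ij0 : (0 < i + j)%N by rewrite addn_gt0 i0.
have [Q coprodE ->] := lamP i0 j0.
transitivity ((coprod (t (i + j)%N))@_(ucm A, ucm B)).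
  rewrite mcoeff_coprod.
  rewrite (big_tree_combination (fun F => (coprod_forest K F)@_(ucm A, ucm B))
    (t_comb ij0) tD).
  by apply: eq_bigr => T _; rewrite coprod_forest_ucm mcoeff_coprod_tree.
rewrite coprodE raddf_sum -(mcoeff_sum Q) !mulr_suml; apply: eq_bigr => -[p1 p2] _.
rewrite /= mcoeffZ mcoeff_tens !mcoeff_seq_monomial Aj Bi xpair_eqE -mulnb natrM.
ring.
Qed.

(** Provides the finite sets over which the sums of [Lambda_ncuts] and [ncuts_preLie] run. *)
Lemma exists_tree_cover N : exists D : {fset tree},
  forall n T, (n <= N)%N -> ucm T \in msupp (t n) ->
  T \in D /\ forall p, p \in tree_cuts T ->
    (of_planar p.1 \in D) && (of_planar p.2 \in D).
Proof.
pose pieces (T : tree) : seq tree :=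
  T :: [seq of_planar p.1 | p <- tree_cuts T] ++ [seq of_planar p.2 | p <- tree_cuts T].
pose forest_pieces (F : forest) := flatten [seq pieces T | T <- enum_fset (finsupp F)].
pose r := flatten [seq flatten [seq forest_pieces F | F <- enum_fset (msupp (t n))]
                  | n <- iota 0 N.+1].
exists [fset T in r] => n T nN Tn.
have inD T' : T' \in pieces T -> T' \in r.
  move=> T'T; apply/flatten_mapP; exists n; first by rewrite mem_iota.
  apply/flatten_mapP; exists (ucm T) => //.
  by apply/flatten_mapP; exists T => //; rewrite mdomU inE.
rewrite in_fset inD ?mem_head //; split=> // p pT.
by rewrite !in_fset !inD // inE mem_cat ?(map_f (fun p => of_planar p.1) pT)
  ?(map_f (fun p => of_planar p.2) pT) !orbT.
Qed.

Hypothesis t_neq0 : forall n, (0 < n)%N -> t n != 0.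

Lemma exists_tree_mcoeff_neq0 n : (0 < n)%N ->
  exists2 T : tree, nvertices T = n & (t n)@_(ucm T) != 0.
Proof.
move=> n0; have := t_neq0 n0; rewrite -msupp_eq0 => /fset0Pn[F Ft].
have [T eF nT] := t_comb n0 Ft.
by exists T => //; rewrite mcoeff_neq0 -eF.
Qed.

(** The pre-Lie identity is summed over the trees U of t_(i+j+k), weighted by their coefficients.
    Two uses of [Lambda_ncuts] evaluate each double sum: [L] for successive cuts of the trunk, [M]
    for a cut inside the branch. *)
Lemma Lambda_preLie i j k : (0 < i)%N -> (0 < j)%N -> (0 < k)%N ->
  lam i j * lam (i + j)%N k - lam j k * lam i (j + k)%N
  = lam i k * lam (i + k)%N j - lam k j * lam i (j + k)%N.
Proof.
move=> i0 j0 k0.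
have [B Bi aB] := exists_tree_mcoeff_neq0 i0.
have [A Aj aA] := exists_tree_mcoeff_neq0 j0.
have [C Ck aC] := exists_tree_mcoeff_neq0 k0.
pose n := (i + j + k)%N.
have [D DP] := exists_tree_cover n.
have inD m T : (m <= n)%N -> ucm T \in msupp (t m) -> T \in D.
  by move=> mn /(DP _ _ mn) [].
pose a m T := (t m)@_(ucm T).
have L j' k' (X Y : tree) : (i + j' + k')%N = n -> (0 < j')%N -> (0 < k')%N ->
    nvertices X = k' -> nvertices Y = j' ->
    \sum_(U <- D) a n U * (\sum_(T <- D) (ncuts X T U)%:R * (ncuts Y B T)%:R)
    = lam (i + j')%N k' * lam i j' * (a k' X * a j' Y * a i B).
  move=> eq_n j'0 k'0 Xk Yj.
  transitivity (\sum_(T <- D) (ncuts Y B T)%:R *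
      (\sum_(U <- D) a n U * (ncuts X T U)%:R)).
    under eq_bigr do rewrite mulr_sumr; under [RHS]eq_bigr do rewrite mulr_sumr.
    by rewrite exchange_big; do 2![apply: eq_bigr => ? _]; ring.
  transitivity (\sum_(T <- D) lam (i + j')%N k' * a k' X *
      (a (i + j')%N T * (ncuts Y B T)%:R)).
    (* An intermediate tree T that contributes has i + j' vertices, as [Lambda_ncuts] requires. *)
    apply: eq_bigr => T _; have [->|/ncuts_nvertices nT] := eqVneq (ncuts Y B T) 0%N.
      by rewrite !mulr0 mul0r.
    rewrite /a -eq_n Lambda_ncuts //; last by rewrite -nT Yj Bi addnC.
      ring.
    by move=> T'; rewrite eq_n; apply: inD.
  rewrite -mulr_sumr Lambda_ncuts //; first by rewrite /a; ring.
  by move=> T'; apply: inD; rewrite -eq_n leq_addr.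
have M j' k' (X Y : tree) : (j' + k')%N = (j + k)%N -> (0 < j')%N -> (0 < k')%N ->
    nvertices X = k' -> nvertices Y = j' ->
    \sum_(U <- D) a n U * (\sum_(T <- D) (ncuts T B U)%:R * (ncuts X Y T)%:R)
    = lam j' k' * lam i (j + k)%N * (a k' X * a j' Y * a i B).
  move=> eq_jk j'0 k'0 Xk Yj.
  have eq_n : (i + (j' + k'))%N = n by rewrite eq_jk addnA.
  transitivity (\sum_(T <- D) (ncuts X Y T)%:R *
      (\sum_(U <- D) a n U * (ncuts T B U)%:R)).
    under eq_bigr do rewrite mulr_sumr; under [RHS]eq_bigr do rewrite mulr_sumr.
    by rewrite exchange_big; do 2![apply: eq_bigr => ? _]; ring.
  transitivity (\sum_(T <- D) lam i (j' + k')%N * a i B *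
      (a (j' + k')%N T * (ncuts X Y T)%:R)).
    apply: eq_bigr => T _; have [->|/ncuts_nvertices nT] := eqVneq (ncuts X Y T) 0%N.
      by rewrite !mulr0 mul0r.
    rewrite /a -eq_n Lambda_ncuts //; last by rewrite -nT Yj Xk addnC.
      ring.
    by move=> T'; rewrite eq_n; apply: inD.
  rewrite -mulr_sumr Lambda_ncuts //; first by rewrite /a eq_jk; ring.
  by move=> T'; apply: inD; rewrite -eq_n leq_addl.
have : \sum_(U <- D) a n U * (\sum_(T <- D) (ncuts C T U)%:R * (ncuts A B T)%:R
          - \sum_(T <- D) (ncuts T B U)%:R * (ncuts C A T)%:R)
     = \sum_(U <- D) a n U * (\sum_(T <- D) (ncuts A T U)%:R * (ncuts C B T)%:R
          - \sum_(T <- D) (ncuts T B U)%:R * (ncuts A C T)%:R).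
  apply: eq_bigr => U _; have [Un|Un] := boolP (ucm U \in msupp (t n)).
    by rewrite ncuts_preLie //; have [] := DP _ _ (leqnn n) Un.
  by rewrite /a mcoeff_outdom // !mul0r.
have e x y z : \sum_(U <- D) x U * (y U - z U)
    = \sum_(U <- D) x U * y U - \sum_(U <- D) x U * z U :> K.
  by rewrite -sumrB; apply: eq_bigr => U _; rewrite mulrBr.
have ikj : (i + k + j)%N = n by rewrite /n; lia.
rewrite !e (L j k C A erefl) // (M j k C A erefl) // (L k j A C ikj) //.
rewrite (M k j A C (addnC k j)) //.
(* The trees A, B, C were chosen in the supports of t_j, t_i, t_k, so this common factor cancels. *)
have nz : a k C * a j A * a i B != 0 by rewrite !mulf_neq0.
move=> h; apply: (mulIf nz).
transitivity (lam (i + j)%N k * lam i j * (a k C * a j A * a i B)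
   - lam j k * lam i (j + k)%N * (a k C * a j A * a i B)); first by ring.
by rewrite h; ring.
Qed.

End LambdaArray.
End SeqMonomials.

(** * Degrees of shifted polynomials *)

Section Polynomials.
Variable K : fieldType.

Lemma leq_size_deriv (p : {poly K}) : (size p^`() <= (size p).-1)%N.
Proof. exact: size_poly. Qed.

(** The second-order Taylor remainder loses two degrees. Writing E(p) for it, the induction rests on
    E(q X + a) = E(q) (X + c) + c^2 q'. *)
Lemma size_taylor2 (p : {poly K}) (c : K) :
  (size (p \Po ('X + c%:P) - p - c *: p^`())%R <= (size p).-2)%N.
Proof.
pose E (q : {poly K}) := q \Po ('X + c%:P) - q - c *: q^`().
rewrite -/(E p); elim/poly_ind: p => [|q a IH].
  by rewrite /E comp_poly0 deriv0 scaler0 !subr0 size_poly0.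
have -> : E (q * 'X + a%:P) = E q * ('X + c%:P) + (c ^+ 2) *: q^`().
  rewrite /E comp_poly_MXaddC derivD derivM derivX derivC -!mul_polyC; ring.
have [->|q0] := eqVneq q 0.
  by rewrite /E comp_poly0 deriv0 !scaler0 !subr0 mul0r addr0 size_poly0.
rewrite size_MXaddC (negPf q0) /=.
apply: leq_trans (size_polyD _ _) _; rewrite geq_max; apply/andP; split; last first.
  by apply: leq_trans (size_scale_leq _ _) _; apply: leq_size_deriv.
have [->|Eq0] := eqVneq (E q) 0; first by rewrite mul0r size_poly0.
rewrite size_Mmonic ?monicXaddC // size_XaddC addn2 /=.
by move: IH Eq0; rewrite -size_poly_gt0; case: (size q) => [|[|m]] /=; case: (size (E q)).
Qed.

Lemma coefM_top (p q : {poly K}) m n : (size p <= m.+1)%N -> (size q <= n.+1)%N ->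
  (p * q)`_(m + n) = p`_m * q`_n.
Proof.
move=> pm qn; have im : (m < (m + n).+1)%N by rewrite ltnS leq_addr.
rewrite coefM (bigD1 (Ordinal im)) //= addKn big1 ?addr0 // => i im'.
have [lt_im|le_mi] := ltnP i m.
  by rewrite [q`_ _]nth_default ?mulr0 // (leq_trans qn) //; lia.
rewrite [p`_ _]nth_default ?mul0r // (leq_trans pm) // ltn_neqAle le_mi andbT.
by apply: contra im' => /eqP mi; apply/eqP/val_inj.
Qed.

Hypothesis charK0 : [pchar K] =i pred0.

(* The coefficient in degree deg p + deg q - 1 is                             *)
(* lead_coef p * lead_coef q * (deg q - k deg p).                             *)
Lemma size_shift_commutator (p q : {poly K}) (l k : nat) :
  (0 < l)%N -> (1 < k)%N -> size p = l.+1 -> q != 0 -> (size q <= l.+1)%N ->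
  (l + (size q).-1 <= size (p * (q \Po ('X + 1%:P)) - q * (p \Po ('X + k%:R%:P)))%R)%N.
Proof.
move=> l0 k1 sp q0 sq.
pose z := p * (q \Po ('X + 1%:P)) - q * (p \Po ('X + k%:R%:P)); rewrite -/z.
have [d sqd] : exists d, size q = d.+1.
  by exists (size q).-1; rewrite prednK // size_poly_gt0.
have dl : (d <= l)%N by rewrite -ltnS -sqd.
rewrite sqd /=.
pose p2 := p \Po ('X + k%:R%:P) - p - k%:R *: p^`().
pose q2 := q \Po ('X + 1%:P) - q - 1 *: q^`().
have zE : z = p * q^`() - k%:R *: (q * p^`()) + (p * q2 - q * p2).
  by rewrite /z /p2 /q2 scale1r -!mul_polyC; ring.
have small (r s : {poly K}) : (size r + size s <= l + d)%N -> (r * s)`_(l + d).-1 = 0.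
  move=> h; apply: nth_default; apply: leq_trans (size_polyMleq _ _) _.
  by rewrite -!subn1 leq_sub2r.
have p20 : (q * p2)`_(l + d).-1 = 0.
  apply: small; have := size_taylor2 p k%:R; rewrite -/p2 sqd sp /=.
  by move: (size _) => n; lia.
have q20 : (p * q2)`_(l + d).-1 = 0.
  have h := size_taylor2 q 1; rewrite -/q2 sqd /= in h.
  (* For d = 0 the truncated size bound is one short of what [small] needs, but then it forces [q2]
     to vanish. *)
  case: d h dl sqd small p20 => [|d] /= h dl sqd small p20; last first.
    by apply: small; rewrite sp; move: (size _) h => n; lia.
  by move: h; rewrite leqn0 size_poly_eq0 => /eqP->; rewrite mulr0 coef0.
have qp' : (q * p^`())`_(l + d).-1 = q`_d * (p`_l *+ l).
  have -> : (l + d).-1 = (d + l.-1)%N by lia.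
  rewrite coefM_top ?sqd ?prednK //; last first.
    by apply: leq_trans (leq_size_deriv _) _; rewrite sp.
  by rewrite coef_deriv prednK.
have pq' : (p * q^`())`_(l + d).-1 = p`_l * (q`_d *+ d).
  case: d sqd {dl small p20 q20 qp'} => [|d] sqd.
    have -> : q^`() = 0.
      apply/eqP; rewrite -size_poly_eq0 -leqn0.
      by apply: leq_trans (leq_size_deriv _) _; rewrite sqd.
    by rewrite mulr0 coef0 mulr0n mulr0.
  have -> : (l + d.+1).-1 = (l + d)%N by rewrite addnS.
  rewrite coefM_top ?sp //; first by rewrite coef_deriv.
  by apply: leq_trans (leq_size_deriv _) _; rewrite sqd.
suff z0 : z`_(l + d).-1 != 0.
  apply: contraR z0; rewrite -ltnNge => h; rewrite nth_default ?eqxx //.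
  by rewrite -ltnS prednK // addn_gt0 l0.
have natK := (pcharf0P K).1 charK0.
have pl : p`_l != 0.
  by have := lead_coef_eq0 p; rewrite lead_coefE sp /= -size_poly_eq0 sp => ->.
have qd : q`_d != 0.
  by have := lead_coef_eq0 q; rewrite lead_coefE sqd /= -size_poly_eq0 sqd => ->.
rewrite zE coefD coefB coefZ coefB p20 q20 pq' qp' subr0 addr0.
have -> : p`_l * (q`_d *+ d) - k%:R * (q`_d * (p`_l *+ l))
        = - (p`_l * q`_d * (k * l - d)%:R).
  rewrite natrB ?natrM; last by nia.
  ring.
(* k >= 2 and d <= l give k l - d >= l > 0; for k = 1 and d = l this factor would vanish. *)
rewrite oppr_eq0 !mulf_neq0 // natK; apply/eqP; nia.
Qed.

(** In characteristic zero the positive integers are infinitely many distinct roots of p - q. *)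
Lemma poly_eq_natr (p q : {poly K}) :
  (forall i, (0 < i)%N -> p.[i%:R] = q.[i%:R]) -> p = q.
Proof.
move=> pq; apply/eqP; rewrite -subr_eq0; apply: contraT => r0.
have natK := (pcharf0P K).1 charK0.
pose rs : seq K := [seq i.+1%:R | i <- iota 0 (size (p - q))].
have rs_root : all (root (p - q)) rs.
  by apply/allP => _ /mapP[i _ ->]; rewrite rootE hornerD hornerN pq ?subrr.
have rs_uniq : uniq rs.
  rewrite map_inj_uniq ?iota_uniq // => i j /eqP.
  wlog le_ij : i j / (i <= j)%N => [th|].
    by case/orP: (leq_total i j) => h e; [apply: th|apply/esym/th]; rewrite // eq_sym.
  by rewrite eq_sym -subr_eq0 -natrB // natK => h; lia.
by have := max_poly_roots r0 rs_root rs_uniq; rewrite size_map size_iota ltnn.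
Qed.

End Polynomials.

(** * Corollas and their cuts *)

Definition internal (u : ptree) : bool := pchildren u != [::].

Lemma corollaP (T : tree) :
  ~~ has internal (pchildren T) -> T = corolla (nvertices T).
Proof.
rewrite -[LHS]of_planarK; case: (planar T) => s /= /hasPn s_leaf.
have -> : s = nseq (size s) pleaf.
  by apply/all_pred1P/allP => -[[|u r]] // /s_leaf; rewrite /internal.
by rewrite /corolla nvertices_PNode map_nseq sumn_nseq mul1n.
Qed.

Lemma nvertices_corolla n : (0 < n)%N -> nvertices (corolla n) = n.
Proof.
move=> n0; rewrite nvertices_of_planar nvertices_PNode map_nseq sumn_nseq.
by rewrite mul1n prednK.
Qed.

Lemma mem_forest_cuts s1 u s2 : (u, s1 ++ s2) \in forest_cuts (s1 ++ u :: s2).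
Proof.
elim: s1 => [|v s1 IH] /=; first exact: mem_head.
rewrite inE mem_cat (_ : (u, v :: s1 ++ s2) \in [seq (p.1, v :: p.2) | p <- _]) ?orbT //.
by apply/mapP; exists (u, s1 ++ s2).
Qed.

(** Either the edge lies above a root and a whole tree goes, or it lies inside a tree, which is then
    not a leaf. The number of trees kept in the second case drives the induction of
    [mcoeff_noncorolla]. *)
Lemma forest_cuts_cases p s : p \in forest_cuts s ->
  perm_eq (p.1 :: p.2) s \/ size p.2 = size s /\ has internal s.
Proof.
elim/pforest_ind: s p => [|s1 s2 IH1 IH2] p //=.
rewrite inE mem_cat => /or3P[/eqP-> /=|/mapP[_ /mapP[q q_in ->] ->]|/mapP[q q_in ->]] /=.
- by left; apply: perm_refl.
- by right; case: s1 q_in {IH1}.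
- case: (IH2 q q_in) => [h|[-> ->]]; last by right; rewrite orbT.
  by left; rewrite (perm_catCA [:: _] [:: _]) /= perm_cons.
Qed.

Lemma ncuts_corolla A B n : A != of_planar pleaf -> ncuts A B (corolla n) = 0%N.
Proof.
move=> A_leaf; rewrite ncuts_of_planar /ncuts big_tree_cuts big_seq big1 // => p /=.
move=> p_in; suff -> : p.1 = pleaf by rewrite eq_sym (negPf A_leaf).
elim: n.-1 p p_in => [|m IH] p //=; rewrite inE => /orP[/eqP-> //|/mapP[q q_in ->]].
exact: IH q_in.
Qed.

(** * Vanishing of the array beyond j = 1, and the two implications *)

Section Main.
Variable K : fieldType.
Hypothesis charK0 : [pchar K] =i pred0.
Variables (t : nat -> HCK K) (lam : nat -> nat -> K).
Hypothesis t_comb : forall n, (0 < n)%N -> tree_combination n (t n).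
Hypothesis t_neq0 : forall n, (0 < n)%N -> t n != 0.
Hypothesis lamP : Lambda_array t lam.

Lemma mcoeff_noncorolla n (T : tree) :
  (forall i j, (0 < i)%N -> (1 < j)%N -> lam i j = 0) ->
  (0 < n)%N -> has internal (pchildren T) -> (t n)@_(ucm T) = 0.
Proof.
move=> lam0 n0; move: {2}(size _) (leqnn (size (pchildren T))) => m.
elim: m T => [|m IH] T; first by case: (pchildren T).
move=> le_m T_int; have [nT|] := eqVneq (nvertices T) n; last exact: mcoeff_t.
have [s sE] : exists s, planar T = PNode s by case: (planar T) => s; exists s.
move: le_m T_int; rewrite sE /= => le_m /hasP[u us u_int].
have [s1 [s2 s_eq]] : exists s1 s2, s = s1 ++ u :: s2.
  by case/splitPr: us => s1 s2; exists s1, s2.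
pose A := of_planar u; pose B := of_planar (PNode (s1 ++ s2)).
have A2 : (1 < nvertices A)%N.
  rewrite nvertices_of_planar; case: (u) u_int => -[|v r] // _.
  by rewrite nvertices_PNode /= ltnS addn_gt0 nvertices_gt0.
have B0 := nvertices_gt0 B.
have cut_in : (u, PNode (s1 ++ s2)) \in tree_cuts T.
  by rewrite sE; apply/mapP; exists (u, s1 ++ s2); rewrite // s_eq mem_forest_cuts.
have nAB : (nvertices B + nvertices A)%N = n.
  by rewrite addnC !nvertices_of_planar (tree_cuts_nvertices cut_in).
have cut_AB : ncuts A B T != 0%N.
  by rewrite /ncuts (big_rem _ cut_in) /= !eqxx.
apply/eqP; apply: contraT => aT.
have [D DP] := exists_tree_cover t n.
have inD T' : ucm T' \in msupp (t n) -> T' \in D by case/(DP _ _ (leqnn n)).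
have := Lambda_ncuts t_comb lamP (D := D) (A := A) (B := B) _ erefl erefl.
rewrite nAB lam0 // !mul0r => /(_ inD).
rewrite (big_fsetD1 T) /=; last by apply: inD; rewrite -mcoeff_neq0.
rewrite big_seq big1 => [/eqP|T']; last first.
  rewrite !inE => /andP[T'T _].
  have [->|/ncuts_neq0[p pT' [pA pB]]] := eqVneq (ncuts A B T') 0%N.
    by rewrite mulr0.
  have [s' s'E] : exists s', planar T' = PNode s' by case: (planar T') => s'; exists s'.
  move: pT'; rewrite s'E => /mapP[q q_in p_eq].
  move: pA pB; rewrite p_eq /= => qA /of_planarP qB.
  (* If A hangs from the root of T', then T' = T. Otherwise T' has as many root children as B, one
     fewer than T, and one of them is not a leaf, so the induction hypothesis kills its
     coefficient. *)
  case: (forest_cuts_cases q_in) => [q_perm|[size_q s'_int]].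
    case/eqP: T'T; rewrite -[T']of_planarK -[T]of_planarK s'E sE; apply/of_planarP.
    rewrite perm_sym in q_perm; apply: perm_trans (perm_map of_planar q_perm) _.
    rewrite s_eq map_cat /= qA perm_sym perm_catC /= perm_cons perm_sym.
    by apply: perm_trans qB _; rewrite map_cat perm_catC.
  rewrite IH ?mul0r // s'E //= -size_q.
  have := perm_size qB; rewrite !size_map => ->.
  by move: le_m; rewrite s_eq !size_cat /= addnS.
(* Characteristic zero keeps the positive count [ncuts A B T] nonzero in K. *)
by rewrite addr0 mulf_eq0 (negPf aT) (pcharf0P K).1 // (negPf cut_AB).
Qed.

(** [Lambda_ncuts] is applied to the corollas with j and i vertices: no single cut of a corolla
    detaches a branch with j >= 2 vertices. *)
Lemma Lambda_corolla (alpha : nat -> K) :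
  (forall n, (0 < n)%N -> alpha n != 0) ->
  (forall n, (0 < n)%N -> t n = alpha n *: tvar K (corolla n)) ->
  forall i j, (0 < i)%N -> (1 < j)%N -> lam i j = 0.
Proof.
move=> alpha0 tE i j i0 j1.
have ij0 : (0 < i + j)%N by rewrite addn_gt0 i0.
have j0 : (0 < j)%N := ltnW j1.
have tc n T : (0 < n)%N -> (t n)@_(ucm T) = alpha n * (corolla n == T)%:R.
  by move=> n0; rewrite tE // mcoeffZ mcoeffU1 (inj_eq (@ucm_inj _)).
have tD T : ucm T \in msupp (t (i + j)%N) -> T \in [fset corolla (i + j)].
  rewrite -mcoeff_neq0 tc // inE [T == _]eq_sym.
  by case: (corolla _ == T); rewrite // mulr0 eqxx.
have := Lambda_ncuts t_comb lamP tD (nvertices_corolla j0) (nvertices_corolla i0).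
rewrite big_seq_fset1 ncuts_corolla ?mulr0.
  move/esym/eqP; rewrite !tc // !eqxx !mulr1 !mulf_eq0.
  by rewrite (negPf (alpha0 _ j0)) (negPf (alpha0 _ i0)) !orbF => /eqP.
apply/eqP => /(congr1 (fun T : tree => nvertices T)).
by rewrite nvertices_corolla // nvertices_of_planar => j_eq; rewrite j_eq in j1.
Qed.

Lemma strong_order_Lambda_eq0 l : (1 < l)%N -> strong_order l lam ->
  forall i j, (0 < i)%N -> (1 < j)%N -> lam i j = 0.
Proof.
move=> l1 [lam_poly [P sP lamP1]].
(* Downward induction on the degree: [m] bounds the gap between the size of q and the maximum l + 1.
   All k are treated at once because each step passes from k to k + 1. *)
have claim m : forall k (q : {poly K}), (1 < k)%N ->
    (forall i, (0 < i)%N -> lam i k = q.[i%:R]) ->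
    (size q <= l.+1)%N -> (l.+1 < size q + m)%N -> q = 0.
  elim: m => [|m IH] k q k1 lamq sq; first by rewrite addn0 ltnNge sq.
  move=> sqm; apply/eqP; apply: contraT => q0.
  have k0 : (0 < k)%N := ltnW k1.
  have [r sr lamr] := lam_poly k.+1 isT.
  (* [Lambda_preLie] at j = 1, turned into an identity of polynomials in i. *)
  have rel : P * (q \Po ('X + 1%:P)) - q * (P \Po ('X + k%:R%:P))
           = (lam 1%N k - lam k 1%N) *: r.
    apply: (poly_eq_natr charK0) => i i0.
    rewrite hornerD hornerN !hornerM hornerZ !horner_comp !hornerD hornerX !hornerC.
    rewrite -lamr // natr1 -natrD -lamP1 // -!lamq ?addn_gt0 ?i0 // -lamP1 ?addn_gt0 ?i0 //.
    have := Lambda_preLie t_comb lamP t_neq0 i0 (ltn0Sn 0) k0.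
    rewrite add1n addn1 => h; rewrite mulrBl; apply/eqP; rewrite -subr_eq0.
    by move/eqP: h; rewrite -subr_eq0 => /eqP <-; apply/eqP; ring.
  have := size_shift_commutator charK0 (ltnW l1) k1 sP q0 sq.
  rewrite rel => /leq_trans /(_ (size_scale_leq _ _)).
  have q_gt0 : (0 < size q)%N by rewrite size_poly_gt0.
  have [r0|r0] := eqVneq r 0; first by rewrite r0 size_poly0; lia.
  move=> lt_qr; case/eqP: r0; apply: (IH k.+1) => //.
  by move: (size q) (size r) q_gt0 lt_qr sqm; lia.
move=> i j i0 j1; have [q sq lamq] := lam_poly j (ltnW j1).
(* The gap l + 2 puts no condition on the size of q. *)
by rewrite lamq // (claim l.+2 j q) ?horner0 ?addnS ?ltnS ?leq_addl.
Qed.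

End Main.

Theorem theorem24 (K : fieldType) (charK0 : [pchar K] =i pred0)
    (l : nat) (l_ge2 : (2 <= l)%N)
    (t : nat -> HCK K) (t_Seq : in_Seq t)
    (lam : nat -> nat -> K) (lamP : Lambda_array t lam) :
  strong_order l lam <->
  (exists2 alpha : nat -> K,
      (forall n, (0 < n)%N -> alpha n != 0)
      & (forall n, (0 < n)%N -> t n = alpha n *: tvar K (corolla n)))
  /\ (exists2 p : {poly K},
      size p = l.+1 & forall i, (0 < i)%N -> lam i 1%N = p.[i%:R]).
Proof.
have [t_spec _ _] := t_Seq.
have t_neq0 n : (0 < n)%N -> t n != 0 by case/t_spec.
have t_comb n : (0 < n)%N -> tree_combination n (t n) by case/t_spec.
split=> [so|[[alpha alpha0 tE] lam1]]; last first.
  (* For j = 1 the given polynomial serves; for j >= 2 the zero polynomial does. *)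
  split=> // -[|[|j]] // _; first by have [p sp pE] := lam1; exists p; rewrite ?sp.
  exists 0; rewrite ?size_poly0 // => i i0; rewrite horner0.
  exact: (Lambda_corolla t_comb lamP alpha0 tE).
split; last by case: so.
have lam0 := strong_order_Lambda_eq0 charK0 t_comb t_neq0 lamP l_ge2 so.
have corollaE n (T : tree) : (0 < n)%N -> (t n)@_(ucm T) != 0 -> T = corolla n.
  move=> n0 aT; have nT : nvertices T = n.
    by apply/eqP; apply: contraNT aT => nT; rewrite (mcoeff_t t_comb).
  rewrite -nT; apply: corollaP; apply: contra aT => T_int.
  by rewrite (mcoeff_noncorolla charK0 t_comb lamP lam0).
(* These scalars are nonzero because t_n is nonzero and the corolla is the only tree that can occur
   in it. *)
exists (fun n => (t n)@_(ucm (corolla n))) => n n0.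
  have [T _ aT] := exists_tree_mcoeff_neq0 t_comb t_neq0 n0.
  by rewrite -(corollaE n T).
apply/malgP => F; rewrite mcoeffZ mcoeffU1.
have [<-|F_cor] := eqVneq; first by rewrite mulr1.
rewrite mulr0; apply/eqP; rewrite mcoeff_eq0; apply: contra F_cor => Ft.
have [T F_eq _] := t_comb n n0 F Ft.
by rewrite F_eq -(corollaE n T) // mcoeff_neq0 -F_eq.
Qed.
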